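(* Let $G$ be a topological group, and let $N$ be a closed normal subgroup of $G$. Suppose that $N$ is Raikov complete and almost metrizable. Let $\widehat q:\rho G\to\rho(G/N)$ be the continuous homomorphic extension of the quotient homomorphism $q:G\to G/N$. Then $\widehat q$ is a quotient homomorphism with kernel $N$ and satisfies $$\widehat q^{-1}(G/N)=G.$$ Consequently, $$r_\rho(G/N)=\widehat q\bigl(r_\rho(G)\bigr).$$ In particular, if $r_\rho(G)$ is pseudocompact, then $r_\rho(G/N)$ is pseudocompact.
   Context: All topological groups are assumed Hausdorff. For a topological group $G$, $\rho G$ denotes its Raikov completion, i.e. the completion with respect to the two-sided group uniformity; $G$ is regarded as a dense topological subgroup of $\rho G$. A topological group is Raikov complete if the natural homomorphism into its Raikov completion is onto. The Raikov remainder of $G$ is the subspace $r_\rho(G)=\rho G\setminus G$ of $\rho G$. Every continuous homomorphism $f:G\to K$ of topological groups extends uniquely to a continuous homomorphism $\widehat f:\rho G\to\rho K$. A topological group $L$ is almost metrizable if it contains a compact subgroup $K$ such that the coset space $L/K$ is metrizable (equivalently, $L$ contains a compact subgroup $K$ with a countable neighbourhood base in $L$). A quotient homomorphism is a continuous, open, surjective homomorphism of topological groups; $G/N$ carries the quotient topology. A Tychonoff space is pseudocompact if every continuous real-valued function on it is bounded; the empty space is regarded as pseudocompact. *)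

(* Defs.v *)
From HB Require Import structures.
From mathcomp Require Import all_boot all_algebra.
From mathcomp Require Import all_classical all_reals.
From mathcomp Require Import topology normedtype.
Import numFieldNormedType.Exports.

Set Implicit Arguments.
Unset Strict Implicit.
Unset Printing Implicit Defensive.

Local Open Scope classical_set_scope.
Local Open Scope quotient_scope.
Local Open Scope group_scope.

(* Hausdorffness is not part of the structure. Continuous homomorphisms are    *)
(* continuous maps in {multiplicative G -> H}, which between groups preserve   *)
(* 1 automatically.                                                            *)
HB.mixin Record isTopologicalGroup G & Topological G & Group G := {
  mulg_continuous : continuous (fun xy : G * G => xy.1 * xy.2);
  invg_continuous : continuous (fun x : G => x^-1)
}.

#[short(type="topologicalGroupType")]
HB.structure Definition TopologicalGroup :=
  {G of Topological G & Group G & isTopologicalGroup G}.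

HB.mixin Record isNormalClosed (G : groupType) (N : {pred G}) := {
  gpredJg : forall x y : G, x \in N -> x ^ y \in N
}.

#[short(type="normalGroupClosed")]
HB.structure Definition NormalGroupClosed (G : groupType) :=
  {N of GroupClosed G N & isNormalClosed G N}.

Definition quotient_homomorphism (G H : topologicalGroupType)
    (f : {multiplicative G -> H}) : Prop :=
  [/\ continuous f, (forall U : set G, open U -> open (f @` U))
    & range f = [set: H]].

Definition kernel (G H : groupType) (f : {multiplicative G -> H}) : set G :=
  f @^-1` [set 1].

Section TopologicalGroupTheory.
Variable G : topologicalGroupType.
Implicit Types (x y : G) (U : set G).

Lemma nbhs_mulg x y U : nbhs (x * y) U ->
  exists A B, [/\ nbhs x A, nbhs y B & forall a b, A a -> B b -> U (a * b)].
Proof.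
move=> /(@mulg_continuous G (x, y)) [[A B] /= [nA nB] AB].
by exists A, B; split => // a b Aa Bb; apply: (AB (a, b)).
Qed.

Lemma nbhs_mulgl x y U : nbhs (x * y) U -> nbhs y [set z | U (x * z)].
Proof.
move=> /nbhs_mulg[A [B [nA nB AB]]]; apply: filterS nB => b; apply: AB.
exact: nbhs_singleton nA.
Qed.

Lemma nbhs_mulgr x y U : nbhs (x * y) U -> nbhs x [set z | U (z * y)].
Proof.
move=> /nbhs_mulg[A [B [nA nB AB]]]; apply: filterS nA => a /AB; apply.
exact: nbhs_singleton nB.
Qed.

Lemma nbhs_invg x U : nbhs x^-1 U -> nbhs x [set z | U z^-1].
Proof. exact: (@invg_continuous G x). Qed.

Lemma nbhs1_mulg U : nbhs (1 : G) U ->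
  exists2 V, nbhs (1 : G) V & forall a b, V a -> V b -> U (a * b).
Proof.
move=> nU; have /nbhs_mulg[A [B [nA nB AB]]] : nbhs (1 * 1 : G) U.
  by rewrite mul1g.
by exists (A `&` B); [exact: filterI | move=> a b [Aa _] [_ Bb]; exact: AB].
Qed.

Lemma nbhs1_invg U : nbhs (1 : G) U -> nbhs (1 : G) [set z | U z^-1].
Proof. by move=> nU; apply: nbhs_invg; rewrite invg1. Qed.

Lemma nbhs1_conjg x U : nbhs (1 : G) U ->
  nbhs (1 : G) [set z | U (x^-1 * z * x)].
Proof.
move=> nU; have : nbhs (x^-1 * 1 * x) U by rewrite mulg1 mulVg.
by move=> /nbhs_mulgr/nbhs_mulgl.
Qed.

End TopologicalGroupTheory.

Section Subgroup.
Variables (G : topologicalGroupType) (N : groupClosed G).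

Definition subgroup : Type := {x : G | x \in N}.

HB.instance Definition _ := SubChoice.copy subgroup {x : G | x \in N}.

Fact subgroup_closed : group_closed (fun x => x \in N).
Proof. by split; [exact: gpred1 | move=> x y; exact: gpredF]. Qed.
HB.instance Definition _ :=
  SubChoice_isSubGroup.Build G (fun x => x \in N) subgroup subgroup_closed.
HB.instance Definition _ := Topological.copy subgroup
  (initial_topology (val : subgroup -> G)).

Lemma subgroup_valM : {morph (val : subgroup -> G) : x y / x * y}.
Proof. exact: valM. Qed.

Lemma subgroup_valV : {morph (val : subgroup -> G) : x / x^-1}.
Proof. exact: gmulfV. Qed.

Lemma nbhs_subgroup (x : subgroup) (U : set subgroup) :
  nbhs x U <-> exists2 V, nbhs (val x) V & val @^-1` V `<=` U.
Proof.
split=> [[_ [[V oV <-] Vx VU]]|[V nV VU]].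
  by exists V => //; exact: open_nbhs_nbhs.
by apply: filterS VU _; exact: (@initial_continuous _ _ (val : subgroup -> G) x).
Qed.

Fact subgroup_mulg_continuous :
  continuous (fun xy : subgroup * subgroup => xy.1 * xy.2).
Proof.
move=> [x y] U /nbhs_subgroup[V nV VU].
have /nbhs_mulg[A [B [nA nB AB]]] : nbhs (val x * val y) V.
  by rewrite -subgroup_valM.
exists (val @^-1` A, val @^-1` B) => /=.
  by split; apply/nbhs_subgroup; [exists A | exists B].
move=> [a b] /= [Aa Bb]; have : V (val a * val b) by exact: AB.
by rewrite -subgroup_valM; exact: VU.
Qed.

Fact subgroup_invg_continuous : continuous (fun x : subgroup => x^-1).
Proof.
move=> x U /nbhs_subgroup[V nV VU].
have /nbhs_invg nV' : nbhs (val x)^-1 V.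
  by rewrite -subgroup_valV.
apply/nbhs_subgroup; exists [set z | V z^-1] => // y /=.
by rewrite -subgroup_valV; exact: VU.
Qed.

HB.instance Definition _ := isTopologicalGroup.Build subgroup
  subgroup_mulg_continuous subgroup_invg_continuous.

End Subgroup.

Section CosetSpace.
Variables (G : topologicalGroupType) (K : groupClosed G).

Definition left_coset_rel : rel G := fun x y => x^-1 * y \in K.

Fact left_coset_rel_equiv : equiv_class_of left_coset_rel.
Proof.
split=> [x|x y|y x z]; rewrite /left_coset_rel.
- by rewrite mulVg gpred1.
- by rewrite -gpredV invgM invgK.
- move=> xy yz; have := gpredM _ _ xy yz.
  by rewrite mulgA mulgK.
Qed.
Canonical left_coset_equiv := EquivRelPack left_coset_rel_equiv.

Definition coset_space : Type := quotient_topology {eq_quot left_coset_equiv}.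
HB.instance Definition _ := Topological.on coset_space.

Definition coset_proj : G -> coset_space := \pi_{eq_quot left_coset_equiv}.

Lemma coset_projP x y : coset_proj x = coset_proj y <-> x^-1 * y \in K.
Proof. by split=> [/eqmodP|?]; [|exact/eqmodP]. Qed.

Lemma coset_proj_surj (c : coset_space) : exists x, coset_proj x = c.
Proof. by exists (repr c); exact: reprK. Qed.

Lemma coset_openE (U : set coset_space) : open U = open (coset_proj @^-1` U).
Proof. by []. Qed.

End CosetSpace.

Section QuotientGroup.
Variables (G : topologicalGroupType) (N : normalGroupClosed G).

Definition quotient_group : Type := coset_space N.
HB.instance Definition _ := Topological.on quotient_group.

Local Notation q := (coset_proj N : G -> quotient_group).

Let mulq (a b : quotient_group) : quotient_group := q (repr a * repr b).
Let invq (a : quotient_group) : quotient_group := q (repr a)^-1.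

Let reprP x : (repr (q x))^-1 * x \in N.
Proof. by apply/coset_projP; exact: reprK. Qed.

Let mulqE x y : mulq (q x) (q y) = q (x * y).
Proof.
apply/coset_projP; rewrite invgM; set r := repr (q x); set s := repr (q y).
have -> : s^-1 * r^-1 * (x * y) = (r^-1 * x) ^ s * (s^-1 * y).
  by rewrite /conjg !mulgA mulgK.
by apply: gpredM; [apply: gpredJg|]; exact: reprP.
Qed.

Let invqE x : invq (q x) = q x^-1.
Proof.
apply/coset_projP; rewrite invgK; set r := repr (q x).
have -> : r * x^-1 = ((r^-1 * x)^-1) ^ r^-1.
  by rewrite /conjg invgM !invgK !mulgA mulgK.
by apply: gpredJg; rewrite gpredV; exact: reprP.
Qed.

Let qP (a : quotient_group) : exists x, a = q x.
Proof. by have [x <-] := coset_proj_surj a; exists x. Qed.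

Let mulqA : associative mulq.
Proof.
move=> a b c; have [[[x ->] [y ->]] [z ->]] := (qP a, qP b, qP c).
by rewrite !mulqE mulgA.
Qed.
Let mul1q : left_id (q 1) mulq.
Proof. by move=> a; have [x ->] := qP a; rewrite mulqE mul1g. Qed.
Let mulq1 : right_id (q 1) mulq.
Proof. by move=> a; have [x ->] := qP a; rewrite mulqE mulg1. Qed.
Let mulVq : left_inverse (q 1) invq mulq.
Proof. by move=> a; have [x ->] := qP a; rewrite invqE mulqE mulVg. Qed.
Let mulqV : right_inverse (q 1) invq mulq.
Proof. by move=> a; have [x ->] := qP a; rewrite invqE mulqE mulgV. Qed.

HB.instance Definition _ :=
  isGroup.Build quotient_group mulqA mul1q mulq1 mulVq mulqV.

Definition quotient_proj : G -> quotient_group := q.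

Fact quotient_projM : {morph quotient_proj : x y / x * y}.
Proof. by move=> x y; rewrite /quotient_proj -mulqE. Qed.
HB.instance Definition _ :=
  isMultiplicative.Build G quotient_group quotient_proj quotient_projM.

HB.instance Definition _ := Multiplicative_isUMagmaMorphism.Build
  G quotient_group quotient_proj (erefl _).

Lemma quotient_projV : {morph quotient_proj : x / x^-1}.
Proof. exact: gmulfV. Qed.

Lemma quotient_projP x y : quotient_proj x = quotient_proj y <-> x^-1 * y \in N.
Proof. exact: coset_projP. Qed.

Lemma quotient_proj_surj (a : quotient_group) : exists x, quotient_proj x = a.
Proof. exact: coset_proj_surj. Qed.

Lemma quotient_proj_continuous : continuous quotient_proj.
Proof. by apply/continuousP. Qed.

Lemma quotient_proj_open (U : set G) : open U -> open (quotient_proj @` U).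
Proof.
rewrite !openE => oU _ [x Ux <-] /=; rewrite /interior nbhsE.
exists (quotient_proj @` U) => //; split; last by exists x.
change (open (quotient_proj @^-1` (quotient_proj @` U))).
rewrite openE => z [y Uy] /quotient_projP yz.
have /oU : U y by [].
rewrite /interior -{1}(mulgK (y^-1 * z) y) => /nbhs_mulgr.
rewrite mulgA mulgV mul1g.
apply: filterS => w Uw; eexists; first exact: Uw.
apply/quotient_projP; rewrite invgM invgK -mulgA mulVg mulg1 //.
Qed.

Lemma quotient_proj_nbhs x (U : set G) :
  nbhs x U -> nbhs (quotient_proj x) (quotient_proj @` U).
Proof.
rewrite nbhsE => -[V [oV Vx] VU]; apply: (filterS (image_subset _ VU)).
by apply: open_nbhs_nbhs; split; [exact: quotient_proj_open | exists x].
Qed.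

Fact quotient_mulg_continuous :
  continuous (fun ab : quotient_group * quotient_group => ab.1 * ab.2).
Proof.
move=> [a b] U /=; have [x <-] := quotient_proj_surj a.
have [y <-] := quotient_proj_surj b; rewrite -gmulfM.
move=> /quotient_proj_continuous/nbhs_mulg[A [B [nA nB AB]]].
exists (quotient_proj @` A, quotient_proj @` B).
  by split; exact: quotient_proj_nbhs.
by move=> [_ _] [/= [c Ac <-] [d Bd <-]]; rewrite -gmulfM; exact: AB.
Qed.

Fact quotient_invg_continuous : continuous (fun a : quotient_group => a^-1).
Proof.
move=> a U /=; have [x <-] := quotient_proj_surj a; rewrite -quotient_projV.
move=> /quotient_proj_continuous/nbhs_invg/quotient_proj_nbhs.
apply: filterS => _ [y Uy <-]; change (U (quotient_proj y)^-1).
by rewrite -quotient_projV.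
Qed.

HB.instance Definition _ := isTopologicalGroup.Build quotient_group
  quotient_mulg_continuous quotient_invg_continuous.

End QuotientGroup.

(* The Hausdorff completion of a uniform space; its points are the minimal     *)
(* Cauchy filters, and x is sent to its neighbourhood filter.                  *)
Section Completion.
Variable T : uniformType.
Implicit Types (F H : set_system T) (A B : set T) (E : set (T * T)).

Definition minimal_cauchy F : Prop :=
  [/\ ProperFilter F, cauchy F &
    forall H, ProperFilter H -> cauchy H -> H `<=` F -> H = F].

Record completion : Type := Completion {
  cfilter : set_system T;
  completionP : minimal_cauchy cfilter
}.

HB.instance Definition _ := gen_eqMixin completion.
HB.instance Definition _ := gen_choiceMixin completion.

Lemma completion_proper (p : completion) : ProperFilter (cfilter p).
Proof. by have [] := completionP p. Qed.

Lemma completion_eq (p q : completion) : cfilter p = cfilter q -> p = q.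
Proof.
by case: p q => [F FP] [H HP] /= FH; move: HP; rewrite -FH => HP;
  congr Completion; exact: Prop_irrelevance.
Qed.

Lemma cauchy_smallP F : Filter F ->
  cauchy F <-> forall E, entourage E -> exists2 A, F A & A `*` A `<=` E.
Proof.
move=> FF; split=> [cF E /cF [[A B] /= [FA FB] AB]|cF E /cF [A FA AE]].
  exists (A `&` B); first exact: filterI.
  by move=> [x y] /= [[Ax _] [_ By]]; exact: AB.
by exists (A, A).
Qed.

Lemma completion_cauchy (p : completion) E :
  entourage E -> exists2 A, cfilter p A & A `*` A `<=` E.
Proof.
have [pF cp _] := completionP p; exact: (iffLR (cauchy_smallP _)).
Qed.

(* Two minimal Cauchy filters contained in a common proper filter are equal. *)
Lemma completion_eq_meet (p q : completion) :
  (forall A B, cfilter p A -> cfilter q B -> A `&` B !=set0) -> p = q.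
Proof.
move=> pq; have pF := completion_proper p; have qF := completion_proper q.
pose I : set_system T := cfilter p `&` cfilter q.
have IF : ProperFilter I.
  split; first by move=> [p0 _]; exact: (@filter_not_empty _ _ pF p0).
  split; first by split; exact: filterT.
    by move=> A B [pA qA] [pB qB]; split; exact: filterI.
  by move=> A B AB [pA qA]; split; exact: filterS AB _.
have cI : cauchy I.
  apply/cauchy_smallP => E entE.
  have [A pA AE] := completion_cauchy p (entourage_split_ent entE).
  have [B qB BE] := completion_cauchy q (entourage_split_ent entE).
  have [c [Ac Bc]] := pq _ _ pA qB.
  exists (A `|` B).
    by split; [exact: filterS (@subsetUl _ A B) _ | exact: filterS (@subsetUr _ A B) _].
  have H z t : (A `|` B) z -> (A `|` B) t -> E (z, t).
    by move=> ABz ABt; apply: (entourage_split c entE);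
      [case: ABz => ? | case: ABt => ?]; (exact: AE || exact: BE).
  by move=> [x y] /= [? ?]; exact: H.
have [_ _ mp] := completionP p; have [_ _ mq] := completionP q.
have pI : I = cfilter p by apply: mp => // A [].
have qI : I = cfilter q by apply: mq => // A [].
by apply: completion_eq; rewrite -pI -qI.
Qed.

(* Every Cauchy filter contains exactly one minimal Cauchy filter. *)
Definition roundify F : set_system T :=
  [set A | exists2 E, entourage E &
    exists2 B, F B & forall x y, B x -> E (x, y) -> A y].

Lemma roundify_sub F : Filter F -> roundify F `<=` F.
Proof.
move=> FF A [E entE [B FB BA]]; apply: filterS FB => x Bx.
by apply: BA Bx _; exact: entourage_refl.
Qed.

Lemma roundify_minimal F : ProperFilter F -> cauchy F ->
  minimal_cauchy (roundify F).
Proof.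
move=> FF cF; have rF := @roundify_sub F _.
have RF : ProperFilter (roundify F).
  split; first by move=> /rF; exact: filter_not_empty.
  split; first by exists setT; [exact: entourageT | exists setT; first exact: filterT].
    move=> A B [E entE [C FC CA]] [E' entE' [D FD DB]].
    exists (E `&` E'); first exact: filterI.
    exists (C `&` D); first exact: filterI.
    by move=> x y [Cx Dx] [Exy E'xy]; split; [exact: CA Cx _ | exact: DB Dx _].
  move=> A B AB [E entE [C FC CA]]; exists E => //; exists C => // x y Cx Exy.
  by apply: AB; exact: CA Cx Exy.
split=> //.
  apply/cauchy_smallP => E entE; pose E1 := split_ent E; pose E2 := split_ent E1.
  have entE1 : entourage E1 by exact: entourage_split_ent.
  have entE2 : entourage E2 by exact: entourage_split_ent.
  have [A FA AE2] := iffLR (cauchy_smallP _) cF _ entE2.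
  exists [set y | exists2 x, A x & (E2 `&` E1^-1%relation) (x, y)].
    exists (E2 `&` E1^-1%relation).
      by apply: filterI => //; exact: entourage_inv.
    by exists A => // x y Ax Exy; exists x.
  move=> [y y'] /= [[x Ax [_ xy]] [x' Ax' [xy' _]]].
  apply: (entourage_split x entE); first exact: xy.
  by apply: (entourage_split x' entE1) => //; exact: AE2.
move=> H HF cH HR; apply/seteqP; split=> // A [E entE [B FB BA]].
have [C HC CE] := iffLR (cauchy_smallP _) cH _ entE.
have [c [Cc Bc]] : C `&` B !=set0.
  by apply: (@filter_ex _ F); apply: filterI => //; exact/rF/HR.
by apply: filterS HC => y Cy; apply: BA Bc _; exact: CE.
Qed.

Definition completion_of F (FF : ProperFilter F) (cF : cauchy F) :=
  Completion (roundify_minimal FF cF).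

Lemma completion_ofE F (FF : ProperFilter F) (cF : cauchy F) (p : completion) :
  cfilter p `<=` F -> completion_of FF cF = p.
Proof.
move=> pF; apply: completion_eq_meet => A B /= RA /pF FB.
by apply: (@filter_ex _ F); apply: filterI => //; exact: roundify_sub RA.
Qed.

Lemma completion_round (p : completion) A : cfilter p A ->
  exists2 E, entourage E & exists2 B, cfilter p B & forall x y, B x -> E (x, y) -> A y.
Proof.
have [pF cp mp] := completionP p.
have [rF cr _] := roundify_minimal pF cp.
have pE : roundify (cfilter p) = cfilter p.
  by apply: mp => //; exact: (@roundify_sub _ _).
by move=> pA; have : roundify (cfilter p) A by rewrite pE.
Qed.

Definition completion_ent : set_system (completion * completion) :=
  filter_from entourage
    (fun E => [set pq | exists A, [/\ cfilter pq.1 A, cfilter pq.2 A & A `*` A `<=` E]]).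

Let completion_ent_filter : Filter completion_ent.
Proof.
apply: filter_from_filter; first by exists setT; exact: entourageT.
move=> E E' entE entE'; exists (E `&` E'); first exact: filterI.
move=> [p q] /= [A [pA qA AE]].
by split; exists A; split => // x /AE[].
Qed.

Let completion_ent_diag U : completion_ent U -> diagonal `<=` U.
Proof.
move=> [E entE EU] [p q] /diagonalP ->; apply: EU => /=.
by have [A pA AE] := completion_cauchy q entE; exists A.
Qed.

Let completion_ent_inv U : completion_ent U -> completion_ent U^-1%relation.
Proof.
by move=> [E entE EU]; exists E => // -[p q] /= [A [pA qA AE]]; apply: EU; exists A.
Qed.

Let completion_ent_split U : completion_ent U ->
  exists2 V, completion_ent V & (V \; V `<=` U)%relation.
Proof.
move=> [E entE EU].
exists [set pq | exists A, [/\ cfilter pq.1 A, cfilter pq.2 A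
    & A `*` A `<=` split_ent E]].
  by exists (split_ent E) => //; exact: entourage_split_ent.
move=> [p q] /= [r [A [pA rA AE]] [B [rB qB BE]]]; apply: EU => /=.
have rF := completion_proper r.
have [c [Ac Bc]] : A `&` B !=set0 by apply: (@filter_ex _ (cfilter r)); exact: filterI.
have pF := completion_proper p; have qF := completion_proper q.
exists (A `|` B); split.
- exact: filterS (@subsetUl _ A B) _.
- exact: filterS (@subsetUr _ A B) _.
move=> [x y] /= [ABx ABy]; apply: (entourage_split c entE).
  by case: ABx => ?; [exact: (AE (_, _)) | exact: (BE (_, _))].
by case: ABy => ?; [exact: (AE (_, _)) | exact: (BE (_, _))].
Qed.

HB.instance Definition _ := isUniform.Build completion
  completion_ent_filter completion_ent_diag completion_ent_inv
  completion_ent_split.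

Lemma nbhs_completion (p : completion) (U : set completion) :
  nbhs p U <-> exists2 A, cfilter p A & [set q : completion | cfilter q A] `<=` U.
Proof.
rewrite -nbhs_entourageE; split.
  move=> [V [E entE EV] VU].
  have [A pA AE] := completion_cauchy p entE.
  exists A => // q qA; apply: VU; apply/xsectionP; apply: EV => /=.
  by exists A.
move=> [A /completion_round [E entE [B pB BA]] AU].
exists [set pq : completion * completion |
    exists C, [/\ cfilter pq.1 C, cfilter pq.2 C & C `*` C `<=` E]]; first by exists E.
move=> q /xsectionP [C /= [pC qC CE]]; apply: AU => /=.
have pF := completion_proper p; have qF := completion_proper q.
have [c [Bc Cc]] : B `&` C !=set0 by apply: (@filter_ex _ (cfilter p)); exact: filterI.
by apply: filterS qC => x Cx; apply: BA Bc _; exact: (CE (_, _)).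
Qed.

Lemma completion_hausdorff : hausdorff_space completion.
Proof.
move=> p q pq; apply: completion_eq_meet => A B pA qB.
have nA : nbhs p [set r : completion | cfilter r A] by apply/nbhs_completion; exists A.
have nB : nbhs q [set r : completion | cfilter r B] by apply/nbhs_completion; exists B.
have [r [rA rB]] := pq _ _ nA nB.
by have rF := completion_proper r; apply: (@filter_ex _ (cfilter r)); exact: filterI.
Qed.

Let nbhs_cauchy (x : T) : cauchy (nbhs x).
Proof.
apply/cauchy_smallP => E entE.
have entE' := entourage_split_ent entE.
exists (xsection (split_ent E `&` (split_ent E)^-1%relation) x).
  by apply: nbhs_entourage; exact: entourage_invI.
by move=> [y z] /= [/xsectionP[_ xy] /xsectionP[xz _]];
  exact: (entourage_split x entE).
Qed.

Lemma nbhs_minimal_cauchy (x : T) : minimal_cauchy (nbhs x).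
Proof.
split; [exact: nbhs_pfilter | exact: nbhs_cauchy | move=> H HF cH Hx].
apply/seteqP; split=> // A.
rewrite -nbhs_entourageE => -[E entE EA].
have [B FB BE] := iffLR (cauchy_smallP _) cH _ entE.
apply: filterS (FB) => y By; apply/EA/xsectionP; apply: BE; split=> //=.
exact: nbhs_singleton (Hx _ FB).
Qed.

Definition to_completion (x : T) : completion :=
  Completion (nbhs_minimal_cauchy x).

Lemma to_completion_continuous : continuous to_completion.
Proof.
move=> x U /nbhs_completion[A /= nA AU].
by apply: filterS (nbhs_interior nA) => y Ay; exact: AU.
Qed.

Lemma to_completion_embedding (x : T) (U : set T) : nbhs x U <->
  exists2 V, nbhs (to_completion x) V & to_completion @^-1` V `<=` U.
Proof.
split=> [nU|[V nV VU]]; last first.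
  by apply: filterS VU _; exact: to_completion_continuous.
exists [set q : completion | cfilter q U]; first by apply/nbhs_completion; exists U.
by move=> y; exact: nbhs_singleton.
Qed.

Lemma dense_to_completion : dense (range to_completion).
Proof.
move=> U [p Up] oU; have /nbhs_completion[A pA AU] : nbhs p U.
  exact: open_nbhs_nbhs.
have [E entE [B pB BA]] := completion_round pA.
have pF := completion_proper p; have [x Bx] := filter_ex pB.
exists (to_completion x); split; last by exists x.
apply: AU => /=; rewrite -nbhs_entourageE; exists E => // y /xsectionP.
exact: BA.
Qed.

Lemma completion_complete (F : set_system completion) :
  ProperFilter F -> cauchy F -> exists p : completion, F --> p.
Proof.
move=> FF cF.
pose H : set_system T := [set A | F [set p : completion | cfilter p A]].
have HF : ProperFilter H.
  split.
    move=> F0; have [p p0] := @filter_ex _ F FF _ F0.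
    by have pF := completion_proper p; exact: (@filter_not_empty _ _ pF p0).
  split.
  - by apply: (@filterS _ F _ _ _ _ (@filterT _ F _)) => p _;
      have [pF _ _] := completionP p; exact: filterT.
  - move=> A B FA FB; apply: (@filterS _ F _ _ _ _ (@filterI _ F _ _ _ FA FB)) => p [pA pB].
    by have [pF _ _] := completionP p; exact: filterI.
  - move=> A B AB; apply: (@filterS _ F) => p pA.
    by have [pF _ _] := completionP p; exact: filterS AB _.
have cH : cauchy H.
  apply/cauchy_smallP => E entE.
  have entE1 := entourage_split_ent entE.
  have entE2 := entourage_split_ent entE1.
  set E1 := split_ent E in entE1 entE2; set E2 := split_ent E1 in entE2.
  have : entourage [set pq : completion * completion | exists C,
     [/\ cfilter pq.1 C, cfilter pq.2 C & C `*` C `<=` E2]] by exists E2.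
  move=> /cF [[P Q] /= [FP FQ] PQ].
  have [p [Pp Qp]] : P `&` Q !=set0 by apply: (@filter_ex _ F); exact: filterI.
  have pF := completion_proper p.
  have [A pA AE] := completion_cauchy p entE2.
  have [a Aa] := filter_ex pA.
  exists [set y | forall x, A x -> E1 (x, y) /\ E1 (y, x)].
    apply: (@filterS _ F _ _ _ _ (@filterI _ F _ _ _ FP FQ)) => q [Pq Qq] /=.
    have qF := completion_proper q.
    have [C /= [pC qC CE]] := PQ (p, q) (conj Pp Qq).
    have [c [Ac Cc]] : A `&` C !=set0.
      by apply: (@filter_ex _ (cfilter p)); exact: filterI.
    apply: filterS qC => y Cy x Ax; split; apply: (entourage_split c entE1).
    - exact: (AE (_, _)).
    - exact: (CE (_, _)).
    - exact: (CE (_, _)).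
    - exact: (AE (_, _)).
  move=> [y z] /= [yA zA]; apply: (entourage_split a entE).
    by have [] := yA a Aa.
  by have [] := zA a Aa.
exists (completion_of HF cH) => U /nbhs_completion[A /= RA AU].
apply: (@filterS _ F _ _ _ AU); exact: (@roundify_sub H _ _ RA).
Qed.

End Completion.

(* A copy of G carrying the two-sided group uniformity, the join of the left   *)
(* one {x^-1 y \in U} and the right one {x y^-1 \in U}.                        *)
Section TwoSided.
Variable G : topologicalGroupType.
Implicit Types (F H : set_system G) (U : set G).

Definition two_sided : Type := G.
HB.instance Definition _ := Topological.on two_sided.
HB.instance Definition _ := Group.on two_sided.
HB.instance Definition _ := TopologicalGroup.on two_sided.

Definition two_sided_set U : set (two_sided * two_sided) :=
  [set xy | U (xy.1^-1 * xy.2) /\ U (xy.1 * xy.2^-1)].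

Definition two_sided_ent : set_system (two_sided * two_sided) :=
  filter_from (nbhs (1 : G)) two_sided_set.

Let two_sided_filter : Filter two_sided_ent.
Proof.
apply: filter_from_filter; first by exists setT; exact: filterT.
move=> U V nU nV; exists (U `&` V); first exact: filterI.
by move=> [x y] [/= [? ?] [? ?]].
Qed.

Let two_sided_diag A : two_sided_ent A -> diagonal `<=` A.
Proof.
move=> [U nU UA] [x y] /diagonalP ->; apply: UA; split=> /=.
  by rewrite mulVg; exact: nbhs_singleton.
by rewrite mulgV; exact: nbhs_singleton.
Qed.

Let two_sided_inv A : two_sided_ent A -> two_sided_ent A^-1%relation.
Proof.
move=> [U nU UA]; exists [set z | U z^-1]; first exact: nbhs1_invg.
by move=> [x y] [/=]; rewrite !invgM !invgK => ? ?; apply: UA.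
Qed.

Let two_sided_split A : two_sided_ent A ->
  exists2 B, two_sided_ent B & (B \; B `<=` A)%relation.
Proof.
move=> [U nU UA]; have [V nV VU] := nbhs1_mulg nU.
exists (two_sided_set V); first by exists V.
move=> [x z] [y [/= xy yx] [/= yz zy]]; apply: UA; split=> /=.
  by have := VU _ _ xy yz; rewrite mulgA mulgK.
by have := VU _ _ yx zy; rewrite mulgA mulgVK.
Qed.

Let two_sided_nbhs : nbhs = nbhs_ two_sided_ent.
Proof.
rewrite predeq2E => x V; split.
  move=> nV; exists (two_sided_set [set z | V (x * z)]).
    by exists [set z | V (x * z)] => //; apply: nbhs_mulgl; rewrite mulg1.
  by move=> y /xsectionP[/=]; rewrite mulVKg.
move=> [A [U nU UA] AV].
have n1 : nbhs x [set y | U (x^-1 * y)] by apply: nbhs_mulgl; rewrite mulVg.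
have n2 : nbhs x [set y | U (x * y^-1)].
  by apply: (@nbhs_invg _ _ [set z | U (x * z)]); apply: nbhs_mulgl;
    rewrite mulgV.
apply: filterS (filterI n1 n2) => y [? ?].
by apply/AV/xsectionP/UA.
Qed.

HB.instance Definition _ := Nbhs_isUniform_mixin.Build two_sided
  two_sided_filter two_sided_diag two_sided_inv two_sided_split two_sided_nbhs.

Lemma two_sided_cauchyP (F : set_system two_sided) : Filter F ->
  cauchy F <-> forall U, nbhs (1 : G) U -> exists2 A, F A &
    forall x y, A x -> A y -> U (x^-1 * y) /\ U (x * y^-1).
Proof.
move=> FF; split.
  move=> cF U nU; have entU : entourage (two_sided_set U) by exists U.
  have [A FA AU] := iffLR (cauchy_smallP FF) cF _ entU.
  by exists A => // x y Ax Ay; have := AU (x, y) (conj Ax Ay).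
move=> H; apply/cauchy_smallP => E [U nU UE]; have [A FA AU] := H U nU.
by exists A => // -[x y] /= [Ax Ay]; apply: UE; exact: AU.
Qed.

End TwoSided.

Section RaikovCompletion.
Variable G : topologicalGroupType.

Definition raikov : Type := completion (two_sided G).
HB.instance Definition _ := Topological.on raikov.

Definition raikov_in : G -> raikov := @to_completion (two_sided G).

Local Notation system := (set_system (two_sided G)).

Definition mul_filter (F H : system) : system :=
  [set C | exists A B, [/\ F A, H B & forall a b, A a -> B b -> C (a * b)]].

Definition inv_filter (F : system) : system := [set C | F [set x | C x^-1]].

Lemma mul_filter_proper (F H : system) :
  ProperFilter F -> ProperFilter H -> ProperFilter (mul_filter F H).
Proof.
move=> FF HF; split.
  move=> [A [B [FA HB AB]]]; have [a Aa] := @filter_ex _ F _ _ FA.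
  by have [b Bb] := @filter_ex _ H _ _ HB; exact: AB Aa Bb.
split.
- by exists setT, setT; split => //; exact: filterT.
- move=> C D [A [B [FA HB AB]]] [A' [B' [FA' HB' AB']]].
  exists (A `&` A'), (B `&` B'); split.
  + exact: (@filterI _ F).
  + exact: (@filterI _ H).
  + by move=> a b [Aa A'a] [Bb B'b]; split; [exact: AB | exact: AB'].
- move=> C D CD [A [B [FA HB AB]]]; exists A, B; split => // a b Aa Bb.
  by apply: CD; exact: AB.
Qed.

Lemma mul_filter_cauchy (F H : system) : ProperFilter F -> ProperFilter H ->
  cauchy F -> cauchy H -> cauchy (mul_filter F H).
Proof.
move=> FF HF /two_sided_cauchyP cF /two_sided_cauchyP cH.
have MF := mul_filter_proper FF HF.
apply/two_sided_cauchyP => U nU.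
have [V nV VU] := nbhs1_mulg nU; have [W nW WV] := nbhs1_mulg nV.
have VW z : W z -> V z.
  by move=> Wz; rewrite -[z]mulg1; apply: WV => //; exact: nbhs_singleton.
have WWW x y z : W x -> W y -> W z -> U (x * y * z).
  by move=> Wx Wy Wz; apply: VU; [exact: WV | exact: VW].
have [A FA AW] := cF _ nW; have [B HB BW] := cH _ nW.
have [a0 Aa0] := @filter_ex _ F _ _ FA.
have [b0 Bb0] := @filter_ex _ H _ _ HB.
have [A' FA' AW'] := cF _ (nbhs1_conjg b0 nW).
have [B' HB' BW'] := cH _ (nbhs1_conjg a0^-1 nW).
exists [set z | exists a b, [/\ A a, A' a, B b, B' b & z = a * b]].
  exists (A `&` A'), (B `&` B'); split.
  - exact: (@filterI _ F).
  - exact: (@filterI _ H).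
  - by move=> a b [Aa A'a] [Bb B'b]; exists a, b.
move=> _ _ [a [b [Aa A'a Bb B'b ->]]] [c [d [Ac A'c Bd B'd ->]]]; split.
  have [+ _] := BW _ _ Bb Bb0; have [+ _] := BW _ _ Bb0 Bd.
  have [+ _] := AW' _ _ A'a A'c; rewrite /= => w2 w3 w1.
  by have := WWW _ _ _ w1 w2 w3; rewrite invgM !mulgA !mulgK.
have [_ +] := AW _ _ Aa Aa0; have [_ +] := AW _ _ Aa0 Ac.
have [_ +] := BW' _ _ B'b B'd; rewrite /= invgK => w2 w3 w1.
by have := WWW _ _ _ w1 w2 w3; rewrite invgM !mulgA !mulgVK.
Qed.

Lemma inv_filter_proper (F : system) :
  ProperFilter F -> ProperFilter (inv_filter F).
Proof.
move=> FF; split.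
  by move=> F0; have [] := @filter_ex _ F _ _ F0.
split.
- exact: (@filterT _ F).
- by move=> A B FA FB; exact: (@filterI _ F _ _ _ FA FB).
- by move=> A B AB FA; apply: (@filterS _ F _ _ _ _ FA) => x; exact: AB.
Qed.

Lemma inv_filter_cauchy (F : system) : ProperFilter F -> cauchy F ->
  cauchy (inv_filter F).
Proof.
move=> FF /two_sided_cauchyP cF; have IF := inv_filter_proper FF.
apply/two_sided_cauchyP => U nU; have [A FA AU] := cF U nU.
exists [set z | A z^-1].
  by apply: (@filterS _ F _ _ _ _ FA) => x Ax /=; rewrite invgK.
by move=> x y Ax Ay; have := AU _ _ Ax Ay; rewrite !invgK => -[? ?].
Qed.

Let properP (p : raikov) : ProperFilter (cfilter p).
Proof. exact: completion_proper. Qed.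

Let cauchyP (p : raikov) : cauchy (cfilter p).
Proof. by have [] := completionP p. Qed.

Definition raikov_mul (p q : raikov) : raikov :=
  completion_of (mul_filter_proper (properP p) (properP q))
    (mul_filter_cauchy (properP p) (properP q) (@cauchyP p) (@cauchyP q)).

Definition raikov_inv (p : raikov) : raikov :=
  completion_of (inv_filter_proper (properP p))
    (inv_filter_cauchy (properP p) (@cauchyP p)).

Lemma raikov_mul_sub p q A : cfilter (raikov_mul p q) A ->
  mul_filter (cfilter p) (cfilter q) A.
Proof.
have MF := mul_filter_proper (properP p) (properP q).
exact: (@roundify_sub _ _ MF).
Qed.

Lemma raikov_inv_sub p A : cfilter (raikov_inv p) A ->
  cfilter p [set x | A x^-1].
Proof.
have IF := inv_filter_proper (properP p).
exact: (@roundify_sub _ _ IF).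
Qed.

Let raikov_mulA : associative raikov_mul.
Proof.
move=> p q r; apply: completion_eq_meet => C D.
move=> /raikov_mul_sub[P [S [pP /raikov_mul_sub[Q [R [qQ rR QR]]] PS]]].
move=> /raikov_mul_sub[T [R' [/raikov_mul_sub[P' [Q' [pP' qQ' PQ]]] rR' TR]]].
have [a [Pa P'a]] := @filter_ex _ _ (properP p) _ (@filterI _ _ (properP p) _ _ pP pP').
have [b [Qb Q'b]] := @filter_ex _ _ (properP q) _ (@filterI _ _ (properP q) _ _ qQ qQ').
have [c [Rc R'c]] := @filter_ex _ _ (properP r) _ (@filterI _ _ (properP r) _ _ rR rR').
exists (a * (b * c)); split; first by apply: PS => //; exact: QR.
by rewrite mulgA; apply: TR => //; exact: PQ.
Qed.

Let raikov_mul1 : left_id (raikov_in 1) raikov_mul.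
Proof.
move=> p; apply: completion_eq_meet => A B /raikov_mul_sub[C [D [nC pD CD]]] pB.
have [d [Dd Bd]] := @filter_ex _ _ (properP p) _ (@filterI _ _ (properP p) _ _ pD pB).
by exists d; split => //; rewrite -[d]mul1g; apply: CD => //;
  exact: (nbhs_singleton nC).
Qed.

Let raikov_mulr1 : right_id (raikov_in 1) raikov_mul.
Proof.
move=> p; apply: completion_eq_meet => A B /raikov_mul_sub[C [D [pC nD CD]]] pB.
have [d [Dd Bd]] := @filter_ex _ _ (properP p) _ (@filterI _ _ (properP p) _ _ pC pB).
by exists d; split => //; rewrite -[d]mulg1; apply: CD => //;
  exact: (nbhs_singleton nD).
Qed.

Let raikov_mulV : left_inverse (raikov_in 1) raikov_inv raikov_mul.
Proof.
move=> p; apply: completion_eq_meet => A B.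
move=> /raikov_mul_sub[C [D [/raikov_inv_sub pC pD CD]]] n1.
have [d [Cd Dd]] := @filter_ex _ _ (properP p) _ (@filterI _ _ (properP p) _ _ pC pD).
exists 1; split; last exact: (nbhs_singleton n1).
by rewrite -(mulVg d); exact: CD.
Qed.

Let raikov_mulrV : right_inverse (raikov_in 1) raikov_inv raikov_mul.
Proof.
move=> p; apply: completion_eq_meet => A B.
move=> /raikov_mul_sub[C [D [pC /raikov_inv_sub pD CD]]] n1.
have [d [Cd Dd]] := @filter_ex _ _ (properP p) _ (@filterI _ _ (properP p) _ _ pC pD).
exists 1; split; last exact: (nbhs_singleton n1).
by rewrite -(mulgV d); exact: CD.
Qed.

HB.instance Definition _ := isGroup.Build raikov
  raikov_mulA raikov_mul1 raikov_mulr1 raikov_mulV raikov_mulrV.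

Fact raikov_mulg_continuous :
  continuous (fun pq : raikov * raikov => pq.1 * pq.2).
Proof.
move=> [p q] U /nbhs_completion[A [E entE [C [P [Q [pP qQ PQ]]] CA]] AU].
exists ([set r | cfilter r P], [set r | cfilter r Q]).
  by split; apply/nbhs_completion; [exists P | exists Q].
move=> [p' q'] /= [pP' qQ']; apply: AU => /=; exists E => //; exists C => //.
by exists P, Q.
Qed.

Fact raikov_invg_continuous : continuous (fun p : raikov => p^-1).
Proof.
move=> p U /nbhs_completion[A [E entE [C pC CA]] AU].
apply/nbhs_completion; exists [set x | C x^-1] => // q /= qC.
by apply: AU => /=; exists E => //; exists C.
Qed.

HB.instance Definition _ := isTopologicalGroup.Build raikov
  raikov_mulg_continuous raikov_invg_continuous.

Fact raikov_inM : {morph raikov_in : x y / x * y}.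
Proof.
move=> x y; apply/esym; apply: completion_ofE => A /= /nbhs_mulg[B [C [nB nC BC]]].
by exists B, C.
Qed.
HB.instance Definition _ := isMultiplicative.Build G raikov raikov_in raikov_inM.

End RaikovCompletion.

Section RaikovExtension.
Variables (G K : topologicalGroupType) (f : {multiplicative G -> K}).
Hypothesis f_continuous : continuous f.

Let f1 : f 1 = 1.
Proof. by apply: (@mulgI _ (f 1)); rewrite -gmulfM !mulg1. Qed.

Let fV x : f x^-1 = (f x)^-1.
Proof. by apply: (@mulgI _ (f x)); rewrite -gmulfM !mulgV. Qed.

Let image_cauchy (p : raikov G) :
  cauchy (f @ cfilter p : set_system (two_sided K)).
Proof.
have pF := completion_proper p.
apply/two_sided_cauchyP => U nU.
have nU' : nbhs (1 : G) (f @^-1` U) by apply: f_continuous; rewrite f1.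
have cp : cauchy (cfilter p) by have [] := completionP p.
have [A pA AU] := iffLR (two_sided_cauchyP _) cp _ nU'.
exists (f @` A).
  by apply: (@filterS _ (cfilter p) _ _ _ _ pA) => x Ax; exists x.
by move=> _ _ [x Ax <-] [y Ay <-]; have := AU _ _ Ax Ay; rewrite /= !gmulfM !fV.
Qed.

Let image_proper (p : raikov G) :
  ProperFilter (f @ cfilter p : set_system (two_sided K)).
Proof. by have pF := completion_proper p; exact: fmap_proper_filter. Qed.

Let ext (p : raikov G) : raikov K :=
  completion_of (image_proper p) (@image_cauchy p).

Let ext_sub p A : cfilter (ext p) A -> cfilter p (f @^-1` A).
Proof. by have FF := image_proper p; exact: (@roundify_sub _ _ FF). Qed.

Let extM : {morph ext : p q / p * q}.
Proof.
move=> p q; apply: completion_eq_meet => A B.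
move=> /ext_sub/raikov_mul_sub[P [Q [pP qQ PQ]]].
move=> /raikov_mul_sub[C [D [/ext_sub pC /ext_sub qD CD]]].
have pF := completion_proper p; have qF := completion_proper q.
have [a [Pa Ca]] := @filter_ex _ _ pF _ (@filterI _ _ pF _ _ pP pC).
have [b [Qb Db]] := @filter_ex _ _ qF _ (@filterI _ _ qF _ _ qQ qD).
exists (f (a * b)); split; first exact: PQ.
by rewrite gmulfM; exact: CD.
Qed.

Let ext_continuous : continuous ext.
Proof.
move=> p U /nbhs_completion[A [E entE [C pC CA]] AU].
apply/nbhs_completion; exists (f @^-1` C) => // q qC.
by apply: AU => /=; exists E => //; exists C.
Qed.

Lemma raikov_extension : exists g : {multiplicative raikov G -> raikov K},
  continuous g /\ forall x, g (raikov_in x) = raikov_in (f x).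
Proof.
pose m := isMultiplicative.Build (raikov G) (raikov K) ext extM.
pose g : {multiplicative raikov G -> raikov K} := HB.pack ext m.
exists g; split; first exact: ext_continuous.
by move=> x; apply: completion_ofE => A /f_continuous.
Qed.

End RaikovExtension.

Lemma raikov_extension_unique (G K : topologicalGroupType)
    (g h : raikov G -> raikov K) : continuous g -> continuous h ->
  (forall x : G, g (raikov_in x) = h (raikov_in x)) -> g = h.
Proof.
move=> cg ch gh; apply/funext => p; apply: completion_eq_meet => A B gA hB.
have nA : nbhs (g p) [set r | cfilter r A] by apply/nbhs_completion; exists A.
have nB : nbhs (h p) [set r | cfilter r B] by apply/nbhs_completion; exists B.
have : nbhs p ((fun x => cfilter (g x) A) `&` (fun x => cfilter (h x) B)).
  by apply: filterI; [exact: (cg p _ nA) | exact: (ch p _ nB)].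
rewrite nbhsE => -[U [oU Up] UAB].
have [_ [/[swap] -[x _ <-] /UAB[gxA hxB]]] :=
  @dense_to_completion (two_sided G) U (ex_intro _ p Up) oU.
have rF := completion_proper (g (@raikov_in G x)).
apply: (@filter_ex _ _ rF); apply: filterI; first exact: gxA.
by rewrite gh; exact: hxB.
Qed.

Definition raikov_complete (G : topologicalGroupType) : Prop :=
  range (@raikov_in G) = [set: raikov G].

Definition raikov_remainder (G : topologicalGroupType) : set (raikov G) :=
  ~` range (@raikov_in G).
Arguments raikov_remainder : clear implicits.

(* Metrizability and pseudocompactness refer to the real numbers, modelled by  *)
(* an arbitrary realType.                                                      *)
Definition metrizable (R : realType) (X : topologicalType) : Prop :=
  exists d : X -> X -> R,
    [/\ forall x y, d x y = 0%R <-> x = y,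
        forall x y, d x y = d y x,
        forall x y z, (d x z <= d x y + d y z)%R &
        forall x (U : set X), nbhs x U <->
          exists2 e : R, (0 < e)%R & [set y | (d x y < e)%R] `<=` U].

Definition almost_metrizable (R : realType) (L : topologicalGroupType) : Prop :=
  exists K : groupClosed L, compact [set` K] /\ metrizable R (coset_space K).

Definition pseudocompact (R : realType) (X : topologicalType) : Prop :=
  forall f : X -> R, continuous f -> exists M : R, forall x, (`|f x| <= M)%R.

(* Main.v *)
Require Import Defs.
From mathcomp Require Import all_boot all_order all_algebra.
From mathcomp Require Import all_classical all_reals.
From mathcomp Require Import topology normedtype.
Import numFieldNormedType.Exports.
Import Order.TTheory GRing.Theory Num.Theory.

Set Implicit Arguments.
Unset Strict Implicit.
Unset Printing Implicit Defensive.

Local Open Scope classical_set_scope.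
Local Open Scope group_scope.

(** Write q for the projection from G to G/N and qhat for its extension to the
completions.

The kernel of qhat is N because N is complete. A point p with qhat p = 1 is a
Cauchy filter whose members have q-images meeting every neighbourhood of 1, so
every product V B of a neighbourhood V of 1 and a member B meets N; as p = 1 p,
these products form a base of p ([kernel_approx]). Hence p traces a Cauchy
filter on N, which converges in N ([complete_subgroup_closed]). The equation
for the preimage of G/N and the two statements on remainders follow from the
kernel and from surjectivity.

Surjectivity is the heart of the matter: a two-sided Cauchy filter F on G/N has
to be lifted to a two-sided Cauchy filter on G ([lift_ultrafilter]). Almost
metrizability supplies countably many neighbourhoods V n of 1 in G which control
N up to a compact set: for each neighbourhood S of 1, some N `&` V n is covered
by finitely many translates of S ([almost_metrizable_base]). Hence it
suffices to find a decreasing sequence of sets D n, each V n-small on both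
sides, whose images all belong to F. Then for x and y in D n above a small
member of F, the quotient x^-1 y lies in V n and is close to N, hence in
finitely many translates of S, and likewise for x y^-1. An ultrafilter finer
than all the sets D n and all the preimages of members of F picks one translate
on each side, so it is Cauchy.

The sets D n are built one from the other ([refine_cube]). The obstacle is that
a left translate g P is small on the right only if P is small relative to g,
whereas g has to be chosen over a member of F which is small relative to P. The
way out is to choose g0 first, then P small relative to g0, then a member of F
small relative to P, and at last g in a fixed right neighbourhood W g0 above
that member: then g P lies in W (g0 P g0^-1) g0.

Openness of qhat then follows: if V is the trace on G of a neighbourhood W of 1,
then q(V) is a neighbourhood of 1 in G/N, so its closure is a neighbourhood of 1
in the completion; by surjectivity and density, the points near 1 in that
closure are images of elements v w with v in V and w in W ([extension_open]). *)

(** * Neighbourhoods of the identity *)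

Section Neighbourhoods.
Variable G : topologicalGroupType.
Implicit Types U V : set G.

Lemma nbhs1_div U : nbhs (1 : G) U -> exists2 V, nbhs (1 : G) V &
  forall a b, V a -> V b -> U (a^-1 * b) /\ U (a * b^-1).
Proof.
move=> /nbhs1_mulg[V nV VU]; exists (V `&` [set z | V z^-1]).
  by apply: filterI => //; exact: nbhs1_invg.
by move=> a b [Va Va'] [Vb Vb']; split; exact: VU.
Qed.

Lemma nbhs1_mul3 U : nbhs (1 : G) U -> exists2 V, nbhs (1 : G) V &
  forall a b c, V a -> V b -> V c -> U (a * b * c).
Proof.
move=> /nbhs1_mulg[V nV VU]; have [W nW WV] := nbhs1_mulg nV.
exists W => // a b c Wa Wb Wc; apply: VU; first exact: WV.
by rewrite -[c]mulg1; apply: WV => //; exact: nbhs_singleton nW.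
Qed.

Lemma nbhs1_conj_seq (s : seq G) U : nbhs (1 : G) U ->
  nbhs (1 : G) [set u | forall k, k \in s -> U (k^-1 * u * k)].
Proof.
move=> nU; elim: s => [|k s IHs].
  by apply: filterS (@filterT _ _ _) => u _ k; rewrite in_nil.
apply: filterS (filterI (nbhs1_conjg k nU) IHs) => u [Uk Us] l.
by rewrite inE => /orP[/eqP ->|/Us].
Qed.

(** If no finite family of translates of U covered K, the complements of such
families in K would generate a proper filter, whose cluster point p would have
the neighbourhood p U disjoint from a member. *)
Lemma compact_translates (K U : set G) : compact K -> nbhs (1 : G) U ->
  exists s : seq G, forall x, K x -> exists2 k, k \in s & U (k^-1 * x).
Proof.
move=> cK nU; apply: contrapT => ns.
pose F : set_system G := [set C | exists s : seq G,
  forall x, K x -> (forall k, k \in s -> ~ U (k^-1 * x)) -> C x].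
have FF : ProperFilter F.
  split.
    move=> [s sK]; apply: ns; exists s => x Kx; apply: contrapT => nx.
    by apply: (sK x Kx) => k ks Uk; apply: nx; exists k.
  split; first by exists [::].
    move=> A B [s sA] [t tB]; exists (s ++ t) => x Kx st.
    by split; [apply: sA | apply: tB] => // k ks; apply: st;
      rewrite mem_cat ks ?orbT.
  by move=> A B AB [s sA]; exists s => x Kx /(sA x Kx)/AB.
have FK : F K by exists [::].
have [p [Kp clp]] := cK F FF FK.
have FC : F [set x | ~ U (p^-1 * x)].
  by exists [:: p] => x _; apply; rewrite inE.
have np : nbhs p [set x | U (p^-1 * x)] by apply: nbhs_mulgl; rewrite mulVg.
by have [x [/= nUx Ux]] := clp _ _ FC np.
Qed.

End Neighbourhoods.

Lemma ultra_seq_cover (T : Type) (I : eqType) (F : set_system T) (B : set T)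
    (s : seq I) (P : I -> set T) : UltraFilter F -> F B ->
  (forall x, B x -> exists2 i, i \in s & P i x) -> exists i, F (P i).
Proof.
move=> uF; elim: s B => [|i s IHs] B FB sB.
  have [x /sB[i]] := filter_ex FB.
  by rewrite in_nil.
have [FPi|FPi] := in_ultra_setVsetC (P i) uF; first by exists i.
apply: (IHs (B `&` ~` P i)); first exact: filterI.
move=> x [/sB[j]]; rewrite inE => /orP[/eqP ->//|js Px _].
by exists j.
Qed.

(** * Almost metrizable subgroups *)

Section CosetProj.
Variables (G : topologicalGroupType) (K : groupClosed G).

Lemma coset_proj_nbhs x (U : set G) :
  nbhs x U -> nbhs (coset_proj K x) (coset_proj K @` U).
Proof.
rewrite nbhsE => -[V [oV Vx] VU]; apply: (filterS (image_subset _ VU)).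
apply: open_nbhs_nbhs; split; last by exists x.
rewrite coset_openE openE => z [y Vy /coset_projP yz].
have : nbhs (z * (z^-1 * y)) V by rewrite mulVKg; exact: open_nbhs_nbhs.
move=> /nbhs_mulgr; apply: filterS => w Vw; exists (w * (z^-1 * y)) => //.
by apply/coset_projP; rewrite invgM invgM invgK mulgVK.
Qed.

Lemma coset_proj_continuous : continuous (coset_proj K : G -> coset_space K).
Proof. by apply/continuousP => U; rewrite coset_openE. Qed.

End CosetProj.

Section AlmostMetrizable.
Variables (R : realType) (G : topologicalGroupType) (N : normalGroupClosed G).
Hypothesis amN : almost_metrizable R (subgroup N).

(** This is all that the lifting argument needs from the compact subgroup K with
N / K metrizable: balls of radius 1 / (n + 1) around the trivial coset give V n.
Given S = T T, finitely many translates k T cover K; the set of u with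
k^-1 u k in T for all these k is a neighbourhood of 1, so its image in N / K
contains a ball. An element over that ball is u x' with x' in some k T, and
u x' = k (k^-1 u k) (k^-1 x') lies in k T T. *)
Lemma almost_metrizable_base : exists V : nat -> set G,
  (forall n, nbhs (1 : G) (V n)) /\
  forall S, nbhs (1 : G) S -> exists n (s : seq G),
    forall x, x \in N -> V n x -> exists2 k, k \in s & S (k^-1 * x).
Proof.
have [K [cK [d [d0 dC dT dN]]]] := amN.
pose c := coset_proj K : subgroup N -> coset_space K.
have E n : exists V, nbhs (1 : G) V /\
    forall x : subgroup N, V (val x) -> (d (c 1%g) (c x) < n.+1%:R^-1)%R.
  have nc : nbhs (c 1) [set z | (d (c 1%g) z < n.+1%:R^-1)%R].
    by apply/dN; exists (n.+1%:R^-1)%R => //; rewrite invr_gt0 ltr0n.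
  have /nbhs_subgroup[V nV Vc] := coset_proj_continuous nc.
  by exists V; split => // x /Vc.
have [V VE] := choice E; exists V; split=> [n|S nS]; first by have [] := VE n.
have [T nT TS] := nbhs1_mulg nS.
pose vT : set (subgroup N) := val @^-1` T.
have nvT : nbhs (1 : subgroup N) vT by apply/nbhs_subgroup; exists T.
have [s sK] := compact_translates cK nvT.
have /(coset_proj_nbhs K)/dN[e e0 eU] := nbhs1_conj_seq s nvT.
have [n ne] : exists n, (n.+1%:R^-1 < e)%R.
  exists (Num.bound (e^-1)%R); rewrite -[ltRHS]invrK ltf_pV2 ?posrE ?invr_gt0 ?ltr0n //.
  by apply: lt_trans (archi_boundP _) _; rewrite ?invr_ge0 ?ltW ?ltr_nat.
exists n, (map val s) => x xN Vx.
have [u Tu] : (c @` [set u | forall k, k \in s -> vT (k^-1 * u * k)]) (c (Sub x xN)).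
  by apply: eU => /=; apply: lt_trans ne; have [_] := VE n; apply.
move=> /coset_projP/sK[k ks Tk].
exists (val k); first exact: map_f.
have -> : (val k)^-1 * x = val (k^-1 * u * k) * val (k^-1 * (u^-1 * Sub x xN)).
  rewrite -subgroup_valM !mulgA !mulgK subgroup_valM subgroup_valV.
  by rewrite SubK.
by apply: TS Tk; exact: Tu.
Qed.

End AlmostMetrizable.

(** * Lifting Cauchy filters along the projection *)

Section Lifting.
Variables (R : realType) (G : topologicalGroupType) (N : normalGroupClosed G).
Hypothesis amN : almost_metrizable R (subgroup N).
Local Notation q := (quotient_proj N).

(** The bound for N `&` V n persists for elements that are only close to N: an
element x with q x in q(O) is m o with m in N and o in O. *)
Lemma thin_cover : exists V : nat -> set G,
  (forall n, nbhs (1 : G) (V n)) /\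
  forall S, nbhs (1 : G) S -> exists n O (s : seq G), nbhs (1 : G) O /\
    forall x, V n x -> (q @` O) (q x) -> exists2 k, k \in s & S (k^-1 * x).
Proof.
have [V [nV VS]] := almost_metrizable_base amN.
have H n : exists W, nbhs (1 : G) W /\ forall a b, W a -> W b -> V n (a * b^-1).
  by have [W nW WV] := nbhs1_div (nV n); exists W; split => // a b /WV /[apply] -[].
have [W HW] := choice H; exists W; split=> [n|S nS]; first by have [] := HW n.
have [T nT TS] := nbhs1_mulg nS; have [n [s sT]] := VS T nT.
have [nW WV] := HW n.
exists n, (W n `&` T), s; split; first exact: filterI.
move=> x Wx [o [Wo To] qox].
have xoN : x * o^-1 \in N.
  rewrite -gpredV invgM invgK -[o]invgK; apply/quotient_projP.
  by rewrite !quotient_projV qox.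
have [k ks Tk] := sT _ xoN (WV _ _ Wx Wo).
by exists k => //; rewrite -[x](mulgVK o) mulgA; exact: TS.
Qed.

Definition two_sided_small (V D : set G) : Prop :=
  forall x y, D x -> D y -> V (x^-1 * y) /\ V (x * y^-1).

Definition translate (g : G) (P : set G) : set G := [set x | P (g^-1 * x)].

(** A pair (g, P) stands for the translate g P together with its thickening
g P P P. The former carries the link with F, the latter is the set that shrinks
along the construction: the gap between the two leaves room to move g. *)
Definition cube (s : G * set G) : set G :=
  [set x | exists a b c, [/\ s.2 a, s.2 b, s.2 c & x = s.1 * (a * b * c)]].

Variable F : set_system (two_sided (quotient_group N)).
Hypotheses (FF : ProperFilter F) (cF : cauchy F).

Definition captures (s : G * set G) : Prop :=
  nbhs (1 : G) s.2 /\ F (q @` translate s.1 s.2).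

Lemma quotient_cauchy (W : set G) : nbhs (1 : G) W -> exists2 A, F A &
  forall x y, A x -> A y -> (q @` W) (x^-1 * y) /\ (q @` W) (x * y^-1).
Proof.
move=> nW; apply: (iffLR (two_sided_cauchyP FF) cF).
by have := quotient_proj_nbhs N nW; rewrite gmulf1.
Qed.

Lemma translate_sub_cube s : nbhs (1 : G) s.2 -> translate s.1 s.2 `<=` cube s.
Proof.
move=> /nbhs_singleton s1 x sx; exists (s.1^-1 * x), 1, 1; split => //.
by rewrite !mulg1 mulVKg.
Qed.

(** The new centre is w g0, with g0 in g P. Taking w in g P g^-1 keeps w g0 in
g P P, hence the new cube in g P P P. Right smallness is preserved because
w g0 p = (w (g0 p g0^-1)) g0 with w and g0 p g0^-1 in a neighbourhood S1 of 1
chosen beforehand; P' may therefore depend on g0 but not on w, which is chosen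
after P' and moves the centre above a member of F that P' controls. *)
Lemma refine_cube s V : nbhs (1 : G) V -> captures s -> exists t,
  [/\ captures t, cube t `<=` cube s & two_sided_small V (cube t)].
Proof.
case: s => g P nV [/= nP FP].
have [S nS SV] := nbhs1_div nV.
have [S1 nS1 S1S] := nbhs1_mulg nS.
have nW : nbhs (1 : G) (S1 `&` [set t | P (g^-1 * t * g)]).
  by apply: filterI => //; exact: nbhs1_conjg.
have [A1 FA1 A1W] := quotient_cauchy nW.
have [a1 [A1a1 [g0 Pg0 qg0]]] := filter_ex (filterI FA1 FP).
have nQ : nbhs (1 : G) (P `&` S `&` [set t | S1 (g0^-1^-1 * t * g0^-1)]).
  by do 2?apply: filterI => //; exact: nbhs1_conjg.
have [P' nP' P'Q] := nbhs1_mul3 nQ.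
have [A2 FA2 A2P'] := quotient_cauchy nP'.
have [x [A1x A2x]] := filter_ex (filterI FA1 FA2).
have [_ [w [S1w Pw] qw]] := A1W _ _ A1x A1a1.
have qg' : q (w * g0) = x by rewrite quotient_projM qw qg0 mulgVK.
exists (w * g0, P'); split.
- split=> //=; apply: filterS FA2 => z A2z.
  have [[p P'p qp] _] := A2P' _ _ A2x A2z.
  exists (w * g0 * p); first by rewrite /translate/= mulKg.
  by rewrite quotient_projM qg' qp mulVKg.
- move=> _ [a [b [c [/= Pa Pb Pc ->]]]].
  exists (g^-1 * w * g), (g^-1 * g0), (a * b * c); split => //=.
    by have [[]] := P'Q _ _ _ Pa Pb Pc.
  by rewrite !mulgA mulgV mul1g mulgK.
move=> _ _ [a [b [c [/= Pa Pb Pc ->]]]] [a' [b' [c' [/= Pa' Pb' Pc' ->]]]].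
have [[_ Sp] Sgp] := P'Q _ _ _ Pa Pb Pc.
have [[_ Sp'] Sgp'] := P'Q _ _ _ Pa' Pb' Pc'.
set p := a * b * c in Sp Sgp *; set p' := a' * b' * c' in Sp' Sgp' *.
split; first by rewrite invgM -mulgA mulKg; have [] := SV _ _ Sp Sp'.
have [_] := SV _ _ (S1S _ _ S1w Sgp) (S1S _ _ S1w Sgp').
by rewrite /= !invgK !invgM !mulgA !invgK !mulgVK.
Qed.

Lemma lift_ultrafilter : exists U : set_system (two_sided G),
  [/\ ProperFilter U, cauchy U & forall A, F A -> U (q @^-1` A)].
Proof.
have [V [nV VS]] := thin_cover.
(* The implication makes the successor of a cube total, as choice requires. *)
have next (x : nat * (G * set G)) : exists t, captures x.2 ->
    [/\ captures t, cube t `<=` cube x.2 & two_sided_small (V x.1) (cube t)].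
  have [hx|nhx] := pselect (captures x.2); last by exists x.2.
  by have [t ht] := refine_cube (nV x.1) hx; exists t.
have [f fP] := choice next.
pose st := fix st n := if n is m.+1 then f (m, st m) else (1, setT).
have hst n : captures (st n).
  elim: n => [|n /(fP (n, _))[]//]; split; first exact: filterT.
  apply: filterS (@filterT _ F _) => z _.
  by have [x <-] := quotient_proj_surj z; exists x.
pose D n := cube (st n).
have Dsmall n : two_sided_small (V n) (D n.+1) by have [] := fP (n, st n) (hst n).
have Ddecr n m : n <= m -> D m `<=` D n.
  elim: m => [|m IHm]; first by rewrite leqn0 => /eqP ->.
  rewrite leq_eqVlt => /orP[/eqP -> //|]; rewrite ltnS => /IHm.
  by apply: subset_trans; have [] := fP (m, st m) (hst m).
pose B : set_system G :=
  [set C | exists n A, F A /\ forall x, D n x -> A (q x) -> C x].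
have BF : ProperFilter B.
  split.
    move=> [n [A [FA AD]]]; have [nst Fst] := hst n.
    have [z [Az [x /(translate_sub_cube nst) Dx qx]]] := filter_ex (filterI FA Fst).
    by apply: (AD x) => //; rewrite qx.
  split; first by exists 0%N, setT; split => //; exact: filterT.
    move=> A A' [n [C [FC CA]]] [m [C' [FC' CA']]].
    exists (maxn n m), (C `&` C'); split; first exact: filterI.
    move=> x Dx [Cx C'x]; split; [apply: CA | apply: CA'] => //.
      by apply: Ddecr Dx; exact: leq_maxl.
    by apply: Ddecr Dx; exact: leq_maxr.
  move=> A A' AA' [n [C [FC CA]]]; exists n, C; split => // x Dx Cx.
  exact/AA'/CA.
have [U [uU BU]] := ultraFilterLemma BF.
exists U; split; first exact: ultra_proper.
  apply/two_sided_cauchyP => W nW.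
  have [S nS SW] := nbhs1_div nW.
  have [n [O [s [nO Os]]]] := VS S nS.
  have [A FA AO] := quotient_cauchy nO.
  have UC : U (D n.+1 `&` q @^-1` A) by apply: BU; exists n.+1, A.
  have [x0 [Dx0 Ax0]] := filter_ex UC.
  have [k Uk] : exists k, U [set y | S (k^-1 * (x0^-1 * y))].
    apply: (ultra_seq_cover (s := s)) uU UC _ => y [Dy Ay]; apply: Os.
      by have [] := Dsmall n _ _ Dx0 Dy.
    by rewrite quotient_projM quotient_projV; have [] := AO _ _ Ax0 Ay.
  have [l Ul] : exists k, U [set y | S (k^-1 * (x0 * y^-1))].
    apply: (ultra_seq_cover (s := s)) uU UC _ => y [Dy Ay]; apply: Os.
      by have [] := Dsmall n _ _ Dx0 Dy.
    by rewrite quotient_projM quotient_projV; have [] := AO _ _ Ax0 Ay.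
  exists ([set y | S (k^-1 * (x0^-1 * y))] `&` [set y | S (l^-1 * (x0 * y^-1))]).
    exact: filterI.
  move=> y z [ky ly] [kz lz]; split.
    by have [+ _] := SW _ _ ky kz; rewrite !invgM !invgK !mulgA !mulgK.
  by have [+ _] := SW _ _ ly lz; rewrite !invgM !invgK !mulgA !mulgK mulgVK.
by move=> A FA; apply: BU; exists 0%N, A.
Qed.

End Lifting.

(** * Points of the completion as filters *)

Section CauchyFilters.
Variable G : topologicalGroupType.
Implicit Types (p : raikov G) (A : set (two_sided G)).

Lemma cfilter_interior p A :
  cfilter p A -> cfilter p [set x | nbhs (x : two_sided G) A].
Proof.
move=> /completion_round[E entE [B pB BA]].
have pF := completion_proper p; apply: filterS pB => x Bx.
by rewrite /= -nbhs_entourageE; exists E => // y /xsectionP; exact: BA.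
Qed.

Lemma raikov_approx p A (U : set (raikov G)) : cfilter p A -> nbhs p U ->
  exists2 a : G, A a & U (raikov_in a).
Proof.
move=> pA /nbhs_completion[B pB BU]; have pF := completion_proper p.
have [a [Aa na]] := filter_ex (filterI pA (cfilter_interior pB)).
by exists a => //; exact: BU.
Qed.

Lemma raikov_in_continuous : continuous (@raikov_in G).
Proof. exact: (@to_completion_continuous (two_sided G)). Qed.

End CauchyFilters.

Section ExtensionFilters.
Variables (G K : topologicalGroupType) (f : G -> K) (g : raikov G -> raikov K).
Hypotheses (cg : continuous g) (gf : forall x, g (raikov_in x) = raikov_in (f x)).

Lemma extension_cfilter p (B : set (two_sided K)) :
  cfilter (g p) B -> cfilter p (f @^-1` B).
Proof.
move=> gB; have nB : nbhs (g p) [set r | cfilter r B] by apply/nbhs_completion; exists B.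
have /nbhs_completion[A pA AB] := cg nB.
have pF := completion_proper p; apply: filterS (cfilter_interior pA) => x nA.
have /= := AB (@raikov_in G x) nA; rewrite gf; exact: nbhs_singleton.
Qed.

Lemma extension_lift (U : set_system (two_sided G)) (y : raikov K) :
  ProperFilter U -> cauchy U -> (forall A, cfilter y A -> U (f @^-1` A)) ->
  exists p, g p = y.
Proof.
move=> UF cU yU; exists (completion_of UF cU).
apply: completion_eq_meet => A B /extension_cfilter pA /yU UB.
have UA := @roundify_sub _ _ UF _ pA.
by have [x [Ax Bx]] := filter_ex (filterI UA UB); exists (f x).
Qed.

End ExtensionFilters.

(** The trace on N of a Cauchy filter whose members meet N is again a Cauchy
filter, and a limit of the trace is a limit of the whole filter. *)
Lemma complete_subgroup_closed (G : topologicalGroupType) (N : groupClosed G)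
    (p : raikov G) : raikov_complete (subgroup N) ->
  (forall A, cfilter p A -> exists2 x, x \in N & A x) ->
  exists2 x, x \in N & raikov_in x = p.
Proof.
move=> rN pN; have pF := completion_proper p.
pose T : set_system (two_sided (subgroup N)) :=
  [set C | exists2 A, cfilter p A & val @^-1` A `<=` C].
have TF : ProperFilter T.
  split.
    by move=> [A /pN[x xN Ax] A0]; exact: (A0 (Sub x xN)).
  split; first by exists setT => //; exact: filterT.
    move=> C C' [A pA AC] [A' pA' AC']; exists (A `&` A'); first exact: filterI.
    by move=> x [/AC + /AC'].
  by move=> C C' CC' [A pA AC]; exists A => // x /AC/CC'.
have cT : cauchy T.
  apply/two_sided_cauchyP => U /nbhs_subgroup[V nV VU].
  have cp : cauchy (cfilter p) by have [] := completionP p.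
  have [A pA AV] := iffLR (two_sided_cauchyP _) cp _ nV.
  exists (val @^-1` A); first by exists A.
  move=> x y /AV/[apply]; rewrite -!subgroup_valV -!subgroup_valM.
  by move=> [? ?]; split; exact: VU.
have [m _ mE] : range (@raikov_in (subgroup N)) (completion_of TF cT) by rewrite rN.
exists (val m); first exact: valP.
apply/esym; apply: completion_eq_meet => A B pA nB.
have : cfilter (raikov_in m) (val @^-1` B) by apply/nbhs_subgroup; exists B.
rewrite mE => /(@roundify_sub _ _ TF)[C pC CB].
have [x xN [Ax Cx]] := pN _ (filterI pA pC).
by exists x; split => //; exact: (CB (Sub x xN)).
Qed.

(** * The extended projection *)

Lemma morph1 (H L : groupType) (f : {multiplicative H -> L}) : f 1 = 1.
Proof. by apply: (@mulgI _ (f 1)); rewrite -gmulfM !mulg1. Qed.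

Lemma morphV (H L : groupType) (f : {multiplicative H -> L}) x : f x^-1 = (f x)^-1.
Proof. by apply: (@mulgI _ (f x)); rewrite -gmulfM !mulgV morph1. Qed.

Section ExtendedProjection.
Variables (G : topologicalGroupType) (N : normalGroupClosed G).
Variable g : {multiplicative raikov G -> raikov (quotient_group N)}.
Hypothesis cg : continuous g.
Hypothesis gq : forall x : G, g (raikov_in x) = raikov_in (quotient_proj N x).

(** Since p = 1 p, each member A contains some V B with V a neighbourhood of 1
and B in p. As q(B) meets q(V^-1), some b in B is v^-1 times an element of N,
and then v b is in N. *)
Lemma kernel_approx p A : g p = 1 -> cfilter p A -> exists2 x, x \in N & A x.
Proof.
move=> gp1; rewrite -[p]mul1g => /raikov_mul_sub[V [B [nV pB VB]]].
have nV' := nbhs1_invg nV.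
have : cfilter (g p) (quotient_proj N @` [set v | V v^-1]).
  by rewrite gp1; have := quotient_proj_nbhs N nV'; rewrite gmulf1.
move=> /(extension_cfilter cg gq) pq; have pF := completion_proper p.
have [b [Bb [v Vv /quotient_projP vb]]] := filter_ex (filterI pB pq).
by exists (v^-1 * b) => //; exact: VB.
Qed.

Lemma extension_kernel : raikov_complete (subgroup N) ->
  kernel g = @raikov_in G @` [set` N].
Proof.
move=> rN; apply/seteqP; split=> [p /= gp1|_ [x /= xN <-]].
  have [x xN xp] := complete_subgroup_closed rN (fun A => @kernel_approx p A gp1).
  by exists x.
rewrite /kernel/= gq.
have /quotient_projP -> : x^-1 * 1 \in N by rewrite mulg1 gpredV.
by rewrite gmulf1 [RHS](_ : _ = raikov_in 1).
Qed.

Lemma extension_surj (R : realType) : almost_metrizable R (subgroup N) ->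
  range g = [set: raikov (quotient_group N)].
Proof.
move=> amN; apply/seteqP; split=> // y _.
have yF := completion_proper y; have [_ cy _] := completionP y.
have [U [UF cU yU]] := lift_ultrafilter amN yF cy.
by have [p <-] := extension_lift cg gq UF cU yU; exists p.
Qed.

(** The closure in the completion of the image of the trace on G of W contains a
neighbourhood of 1; for g r in it, density yields a in G with a^-1 r in W and
q a = q v for some v in G `&` W, so that g r is the image of v (a^-1 r). *)
Lemma extension_open : range g = [set: raikov (quotient_group N)] ->
  forall U, open U -> open (g @` U).
Proof.
move=> gsurj U; rewrite !openE => oU _ [p Up <-]; rewrite /interior.
have /nbhs1_mulg[W nW WU] : nbhs (1 : raikov G) [set w | U (p * w)].
  by apply: nbhs_mulgl; rewrite mulg1; exact: oU.
have nV : nbhs (1 : G) (@raikov_in G @^-1` W).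
  by apply: raikov_in_continuous; rewrite morph1.
pose V := quotient_proj N @` (@raikov_in G @^-1` W).
have nO : nbhs (1 : raikov (quotient_group N))
    [set s : raikov (quotient_group N) | cfilter s V].
  apply/nbhs_completion; exists V => //.
  by have := quotient_proj_nbhs N nV; rewrite gmulf1.
have : nbhs (g p)
    [set z : raikov (quotient_group N) | cfilter ((g p)^-1 * z : raikov _) V].
  by apply: (@nbhs_mulgl _ (g p)^-1 _
    [set s : raikov (quotient_group N) | cfilter s V]); rewrite mulVg.
apply: filterS => z /= zV; have [r _ rs] : range g ((g p)^-1 * z) by rewrite gsurj.
have nr : nbhs r [set t | W (t^-1 * r)].
  apply: (@nbhs_invg _ r [set t | W (t * r)]); apply: nbhs_mulgr.
  by rewrite mulVg.
have rV : cfilter (g r) V by rewrite rs; exact: zV.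
have [a [v Wv qva] War] :=
  raikov_approx (extension_cfilter cg gq rV) nr.
exists (p * (raikov_in v * ((raikov_in a)^-1 * r))); first exact: WU.
by rewrite !gmulfM morphV !gq qva mulVKg rs mulVKg.
Qed.

End ExtendedProjection.

(** * Remainders *)

Lemma pseudocompact_surj (R : realType) (X Y : topologicalType) (h : X -> Y) :
  continuous h -> range h = [set: Y] -> pseudocompact R X -> pseudocompact R Y.
Proof.
move=> ch hsurj pX f cf.
have [M fM] := pX (f \o h) (fun x => continuous_comp (ch x) (cf _)).
exists M => y; have [x _ <-] : range h y by rewrite hsurj.
exact: (fM x).
Qed.

Theorem theorem3p15 (R : realType) (G : topologicalGroupType)
    (N : normalGroupClosed G)
    (qhat : {multiplicative raikov G -> raikov (quotient_group N)}) :
  hausdorff_space G ->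
  closed [set` N] ->
  raikov_complete (subgroup N) ->
  almost_metrizable R (subgroup N) ->
  continuous qhat ->
  (forall x : G, qhat (raikov_in x) = raikov_in (quotient_proj N x)) ->
  [/\ quotient_homomorphism qhat,
      kernel qhat = @raikov_in G @` [set` N],
      qhat @^-1` range (@raikov_in (quotient_group N)) = range (@raikov_in G),
      raikov_remainder (quotient_group N)
        = qhat @` raikov_remainder G &
      pseudocompact R (raikov_remainder G) ->
      pseudocompact R (raikov_remainder (quotient_group N))].
Proof.
move=> _ _ rN amN cq qE.
have surj := extension_surj cq qE amN.
have ker := extension_kernel cq qE rN.
have pre : qhat @^-1` range (@raikov_in (quotient_group N)) = range (@raikov_in G).
  apply/seteqP; split=> [p [a _ ap]|_ [x _ <-]]; last first.
    by exists (quotient_proj N x) => //; rewrite qE.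
  have [x xa] := quotient_proj_surj a.
  have : kernel qhat ((raikov_in x)^-1 * p).
    by rewrite /kernel/= gmulfM morphV qE xa ap mulVg.
  rewrite ker => -[n _ np]; exists (x * n) => //.
  by rewrite raikov_inM np mulVKg.
have rem : raikov_remainder (quotient_group N) = qhat @` raikov_remainder G.
  apply/seteqP; split=> [y ny|_ [p np <-]].
    have [p _ py] : range qhat y by rewrite surj.
    exists p => //; rewrite /raikov_remainder -pre => -[a _ ap].
    by apply: ny; exists a => //; rewrite ap.
  by move=> qp; apply: np; rewrite -pre.
split=> //; first by split => //; exact: extension_open.
have mem (p : raikov_remainder G) : qhat (val p) \in raikov_remainder (quotient_group N).
  by apply/mem_set; rewrite rem; exists (val p) => //; exact: set_valP.
pose h (p : raikov_remainder G) : raikov_remainder (quotient_group N) :=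
  SigSub (mem p).
have ch : continuous h.
  apply: continuous_comp_initial.
  move=> p; apply: (continuous_comp (@initial_continuous _ _ val p)).
  exact: cq.
apply: (pseudocompact_surj ch); apply/seteqP; split=> // y _.
have : (qhat @` raikov_remainder G) (val y) by rewrite -rem; exact: set_valP.
by move=> [p np py]; exists (SigSub (mem_set np)) => //; exact: val_inj.
Qed.
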